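(* Let $n\in\{2,3\}$. For every perfect matching $M$ of the folded hypercube $FQ_n$, the graph $FQ_n-M$ (obtained from $FQ_n$ by deleting the edges of $M$) is isomorphic to the hypercube $Q_n$.
   Context: The $n$-dimensional hypercube $Q_n$ has vertex set $\{0,1\}^n$ (binary strings $x_1x_2\cdots x_n$), two vertices being adjacent iff they differ in exactly one position. The $n$-dimensional folded hypercube $FQ_n$ is obtained from $Q_n$ by adding the $2^{n-1}$ complementary edges joining each $x_1x_2\cdots x_n$ to $\overline{x}_1\overline{x}_2\cdots\overline{x}_n$, where $\overline{x}_i=1-x_i$. A perfect matching of a graph $G$ is a set of pairwise vertex-disjoint edges covering every vertex, i.e. a matching of size $|V(G)|/2$. *)

(* Defs.v *)
From mathcomp Require Import all_boot.

Set Implicit Arguments.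
Unset Strict Implicit.
Unset Printing Implicit Defensive.

(* A simple graph on a finite type is a symmetric irreflexive relation; its
   edges are two-element sets of vertices. *)
Section Graphs.

Variable T : finType.
Implicit Types (e : rel T) (M : {set {set T}}).

Definition edges e : {set {set T}} :=
  [set [set x; y] | x in T, y in e x].

Definition perfect_matching e M : bool :=
  [&& M \subset edges e, trivIset M & cover M == [set: T]].

Definition del_edges e M : rel T :=
  [rel x y | e x y && ([set x; y] \notin M)].

End Graphs.

Definition isomorphic (T U : finType) (e : rel T) (e' : rel U) : Prop :=
  exists2 f : T -> U, bijective f & forall x y, e' (f x) (f y) = e x y.

Definition hypercube (n : nat) : rel (n.-tuple bool) :=
  [rel x y | #|[set i | tnth x i != tnth y i]| == 1].

Definition complement (n : nat) (x : n.-tuple bool) : n.-tuple bool :=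
  [tuple of map negb x].

Definition folded_hypercube (n : nat) : rel (n.-tuple bool) :=
  [rel x y | hypercube x y || (y == complement x)].

Lemma hypercube_sym n : symmetric (@hypercube n).
Proof.
by move=> x y /=; congr (_ == _); apply: eq_card => i; rewrite !inE eq_sym.
Qed.

Lemma hypercube_irr n : irreflexive (@hypercube n).
Proof.
move=> x; rewrite /hypercube /= eq_card0 // => i.
by rewrite !inE eqxx.
Qed.

Lemma complementK n : involutive (@complement n).
Proof. by move=> x; apply: eq_from_tnth => i; rewrite !tnth_map negbK. Qed.

Lemma folded_hypercube_sym n : symmetric (@folded_hypercube n).
Proof.
move=> x y; rewrite /folded_hypercube [LHS]/= [RHS]/= hypercube_sym.
by rewrite [y == _]eq_sym (can2_eq (@complementK n) (@complementK n)).
Qed.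

(* For n = 0 the only vertex is its own complement. *)
Lemma folded_hypercube_irr n : 0 < n -> irreflexive (@folded_hypercube n).
Proof.
move=> n0 x; rewrite /folded_hypercube [LHS]/= hypercube_irr /=.
apply/eqP => /(congr1 (fun t => tnth t (Ordinal n0))).
by rewrite tnth_map; case: (tnth _ _).
Qed.

(* Main.v *)
Require Import Defs.
From mathcomp Require Import all_boot.

(** [FQ_2] is complete and [FQ_3] is complete bipartite, and [Q_n] is [FQ_n]
    minus the complementary matching [c]. View [M] as an involution [m]. If a
    vertex set [A] is exchanged with its complement by both [m] and [c], then
    the map fixing [A] pointwise and equal to [c \o m] off [A] is a bijection
    that conjugates [m] to [c] and preserves [A]. For [n = 3] take for [A] the
    vertices of even weight, so that preserving [A] means preserving [FQ_3]; for
    [n = 2] take a half-cube [x_i = 0] where [i] separates some matched pair. *)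

(** Covering gives each vertex a matched partner; disjointness makes it unique, since two blocks of
    [M] that share [x] coincide. *)
Lemma matching_involution {T : finType} {e : rel T} {M : {set {set T}}} :
  symmetric e -> perfect_matching e M ->
  exists2 m : T -> T, involutive m &
    (forall x, e x (m x)) /\ (forall x y, ([set x; y] \in M) = (y == m x)).
Proof.
move=> e_sym /and3P[/subsetP sM tM /eqP cM].
have ex_partner x : exists y, e x y && ([set x; y] \in M).
  have /bigcupP[B BM xB] : x \in cover M by rewrite cM inE.
  have /imset2P[a b _ eab defB] := sM _ BM; rewrite unfold_in in eab.
  rewrite defB in BM xB; case/set2P: xB => ->.
    by exists b; rewrite eab.
  by exists a; rewrite e_sym eab setUC.
pose m x := xchoose (ex_partner x).
have mP x : e x (m x) && ([set x; m x] \in M) := xchooseP (ex_partner x).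
have mE x y : ([set x; y] \in M) = (y == m x).
  apply/idP/eqP => [xyM | ->]; last by case/andP: (mP x).
  have /andP[_ xmM] := mP x.
  have eqB : [set x; y] = [set x; m x].
    by rewrite -(def_pblock tM xyM (set21 x y)) -(def_pblock tM xmM (set21 _ _)).
  (* In the degenerate case [y = x] the block is a singleton, so [m x] is [x] too. *)
  have /set2P[yx|//] : y \in [set x; m x] by rewrite -eqB set22.
  by have /set2P[->|->] : m x \in [set x; y] by rewrite eqB set22.
exists m; last by split=> // x; case/andP: (mP x).
by move=> x; apply/esym/eqP; rewrite -mE setUC; case/andP: (mP x).
Qed.

Lemma conjugate_involutions {T : Type} {A : pred T} {m c : T -> T} :
    involutive m -> involutive c ->
    (forall x, A (m x) = ~~ A x) -> (forall x, A (c x) = ~~ A x) ->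
  exists f : T -> T,
    [/\ injective f, forall x, f (m x) = c (f x) & forall x, A (f x) = A x].
Proof.
move=> mK cK Am Ac; pose f x := if A x then x else c (m x).
have Af x : A (f x) = A x.
  by rewrite /f; case Ax: (A x) => //; rewrite Ac Am Ax.
exists f; split=> // [x y fxy | x]; last first.
  by rewrite /f Am mK; case: (A x); rewrite ?cK.
(* Since [f] preserves [A], points with equal images fall under the same branch of [f], and each
   branch is injective. *)
have Axy : A x = A y by rewrite -Af fxy Af.
by move: fxy; rewrite /f Axy; case: (A y) => // /(inv_inj cK)/(inv_inj mK).
Qed.

Lemma hypercubeE n (x y : n.-tuple bool) :
  hypercube x y = (\sum_(i < n) (tnth x i != tnth y i) == 1).
Proof.
rewrite /hypercube /= -sum1dep_card big_mkcond /=.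
by congr (_ == _); apply: eq_bigr => i _; case: (_ != _).
Qed.

(** Complementary vertices differ in [n] positions, so for [n > 1] no complementary edge is a cube
    edge. *)
Lemma hypercube_folded n (x y : n.-tuple bool) : 1 < n ->
  hypercube x y = folded_hypercube x y && (y != complement x).
Proof.
move=> n1; rewrite /folded_hypercube [in RHS]/=.
case: eqP => [->|_]; last by rewrite orbF andbT.
rewrite andbF hypercubeE (eq_bigr (fun=> 1)) => [|i _].
  by rewrite sum1_card card_ord gtn_eqF.
by rewrite tnth_map; case: (tnth x i).
Qed.

Lemma folded_hypercube2E (x y : 2.-tuple bool) :
  folded_hypercube x y = (x != y).
Proof.
rewrite /folded_hypercube [LHS]/= -/(hypercube x y) hypercubeE.
case/tupleP: x => a x; case/tupleP: x => b x; rewrite (tuple0 x).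
case/tupleP: y => a' y; case/tupleP: y => b' y; rewrite (tuple0 y).
rewrite !big_ord_recl big_ord0 !(tnth_nth false) -!val_eqE /=.
by move: a b a' b' => [] [] [] [].
Qed.

(** Weights have different parity iff the number of differing positions is odd, that is 1 (a cube
    edge) or 3 (a complementary edge). *)
Lemma folded_hypercube3E (x y : 3.-tuple bool) :
  folded_hypercube x y = (odd (count id x) != odd (count id y)).
Proof.
rewrite /folded_hypercube [LHS]/= -/(hypercube x y) hypercubeE.
case/tupleP: x => a x; case/tupleP: x => b x; case/tupleP: x => c x.
case/tupleP: y => a' y; case/tupleP: y => b' y; case/tupleP: y => c' y.
rewrite (tuple0 x) (tuple0 y).
rewrite !big_ord_recl big_ord0 !(tnth_nth false) -!val_eqE /=.
by move: a b c a' b' c' => [] [] [] [] [] [].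
Qed.

(** Fixing one coordinate of the square leaves only two vertices. *)
Lemma half_square_pigeonhole {i : 'I_2} {x y z : 2.-tuple bool} :
  tnth x i = tnth y i -> tnth y i = tnth z i -> [|| x == y, y == z | x == z].
Proof.
case/tupleP: x => a x; case/tupleP: x => b x; rewrite (tuple0 x).
case/tupleP: y => a' y; case/tupleP: y => b' y; rewrite (tuple0 y).
case/tupleP: z => a'' z; case/tupleP: z => b'' z; rewrite (tuple0 z).
rewrite !(tnth_nth false) -!val_eqE /=.
case: i => [[|[|//]] _] /= -> ->.
  by move: b b' b'' a'' => [] [] [] [].
by move: a a' a'' b'' => [] [] [] [].
Qed.

(** Take [i] separating [x0] from [m x0]. A pair inside one half would fill it, leaving no room for
    the end of [x0, m x0] in that half. *)
Lemma square_involution_halves {m : 2.-tuple bool -> 2.-tuple bool} :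
    involutive m -> (forall x, m x != x) ->
  exists i, forall x, tnth (m x) i = ~~ tnth x i.
Proof.
move=> mK m_neq; pose x0 := [tuple false; false].
have [i di] : exists i, tnth (m x0) i != tnth x0 i.
  apply/existsP; apply: contraR (m_neq x0); rewrite negb_exists => /forallP eq0.
  by apply/eqP/eq_from_tnth => i; apply/eqP/negPn.
exists i => x; apply/eqP; rewrite -[_ == _]negbK; apply/negP => nx.
have eqx : tnth x i = tnth (m x) i by case: (tnth x i) (tnth _ i) nx => [] [].
(* [z], the end of the pair [x0, m x0] on the side of [x], is [x] or [m x]. *)
have [z zx zm] : exists2 z, tnth (m x) i = tnth z i & tnth (m z) i != tnth z i.
  have [e|ne] := eqVneq (tnth (m x) i) (tnth x0 i); first by exists x0.
  exists (m x0); last by rewrite mK eq_sym.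
  by case: (tnth (m x) i) (tnth x0 i) (tnth (m x0) i) di ne => [] [] [].
case/or3P: (half_square_pigeonhole eqx zx) => /eqP xyz.
- by have := m_neq x; rewrite -xyz eqxx.
- by move: zm; rewrite -xyz mK eqx eqxx.
- by move: zm; rewrite -xyz eqx eqxx.
Qed.

(** An automorphism of the folded cube that carries [M] to the complementary matching carries what
    remains to the cube. *)
Lemma isomorphic_conjugate n {M : {set {set n.-tuple bool}}}
    {m f : n.-tuple bool -> n.-tuple bool} : 1 < n ->
    (forall x y, ([set x; y] \in M) = (y == m x)) ->
    injective f -> (forall x, f (m x) = complement (f x)) ->
    (forall x y, folded_hypercube (f x) (f y) = folded_hypercube x y) ->
  isomorphic (del_edges (@folded_hypercube n) M) (@hypercube n).
Proof.
move=> n1 mE f_inj fm fE; exists f; first exact: injF_bij.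
by move=> x y; rewrite hypercube_folded // fE -fm inj_eq // -mE.
Qed.

Theorem theorem2p1 (n : nat) (hn : n = 2 \/ n = 3)
    (M : {set {set n.-tuple bool}})
    (hM : perfect_matching (@folded_hypercube n) M) :
  isomorphic (del_edges (@folded_hypercube n) M) (@hypercube n).
Proof.
have [m mK [em mE]] := matching_involution (@folded_hypercube_sym n) hM.
case: hn => n_eq; subst n.
- have m_neq x : m x != x by rewrite eq_sym -folded_hypercube2E.
  have [i mi] := square_involution_halves mK m_neq.
  have ci x : tnth (complement x) i = ~~ tnth x i by rewrite tnth_map.
  have [f [f_inj fm _]] := conjugate_involutions mK (@complementK 2) mi ci.
  apply: (isomorphic_conjugate 2 isT mE f_inj fm) => x y.
  by rewrite !folded_hypercube2E inj_eq.
- pose A (x : 3.-tuple bool) := odd (count id x).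
  (* Both [m] and [complement] move each vertex along an edge, so bipartiteness shows that both
     exchange [A] with its complement. *)
  have Ae x y : folded_hypercube x y -> A y = ~~ A x.
    by rewrite folded_hypercube3E -/(A x) -/(A y); case: (A x) (A y) => [] [].
  have Am x : A (m x) = ~~ A x by apply: Ae.
  have Ac x : A (complement x) = ~~ A x.
    by apply: Ae; rewrite /folded_hypercube /= eqxx orbT.
  have [f [f_inj fm Af]] := conjugate_involutions mK (@complementK 3) Am Ac.
  apply: (isomorphic_conjugate 3 isT mE f_inj fm) => x y.
  by rewrite !folded_hypercube3E -!/(A _) !Af.
Qed.
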